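(* Let $W$ be a connected compact $C^\infty$ manifold (without boundary), and let $f:W\to[0,1]$ be a $C^1$ function. Suppose that $\Lambda_0:=f^{-1}(0)$ and $\Lambda_1:=f^{-1}(1)$ are both non-empty $C^1$-embedded submanifolds of $W$. If $f$ has no critical point on $W\setminus(\Lambda_0\cup\Lambda_1)$, then $\Lambda_1$ is a deformation retract of $W\setminus\Lambda_0$.
   Context: A critical point of $f$ is a point of $W$ at which the differential $df$ vanishes. Manifolds and submanifolds are without boundary. *)

(* Defs.v *)
From HB Require Import structures.
From mathcomp Require Import all_boot all_order all_algebra.
From mathcomp Require Import all_classical all_reals all_analysis.

Set Implicit Arguments.
Unset Strict Implicit.
Unset Printing Implicit Defensive.

Import Order.TTheory GRing.Theory Num.Theory.
Import numFieldNormedType.Exports.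

Local Open Scope classical_set_scope.
Local Open Scope ring_scope.

(* [C_k_on k U g]: g is of class C^k on the open set U. Continuity of all
   directional derivatives is continuity of the differential, the source being
   finite-dimensional. *)
Fixpoint C_k_on (R : realType) (n : nat) (V : normedModType R) (k : nat)
    (U : set 'rV[R]_n) (g : 'rV[R]_n -> V) : Prop :=
  match k with
  | 0%N => {within U, continuous g}
  | k'.+1 => (forall x, U x -> differentiable g x) /\
             (forall v : 'rV[R]_n, C_k_on k' U ('D_v g))
  end.

(* [chart_inv] is only meaningful on the image of [chart_dom]. *)
Record chart (R : realType) (n : nat) (W : topologicalType) := Chart {
  chart_dom : set W;
  chart_fun :> W -> 'rV[R]_n;
  chart_inv : 'rV[R]_n -> W;
  chart_dom_open : open chart_dom;
  chart_img_open : open (chart_fun @` chart_dom);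
  chart_funK : forall x, chart_dom x -> chart_inv (chart_fun x) = x;
  chart_fun_continuous : {within chart_dom, continuous chart_fun};
  chart_inv_continuous :
    {within chart_fun @` chart_dom, continuous chart_inv} }.

Definition C_k_transition (R : realType) (n : nat) (W : topologicalType)
    (k : nat) (c d : chart R n W) : Prop :=
  C_k_on k (c @` (chart_dom c `&` chart_dom d)) (d \o chart_inv c).

Definition C_k_compatible (R : realType) (n : nat) (W : topologicalType)
    (k : nat) (c d : chart R n W) : Prop :=
  C_k_transition k c d /\ C_k_transition k d c.

(* The atlas is not required to be maximal. *)
Record smooth_manifold (R : realType) (n : nat) := SmoothManifold {
  carrier :> topologicalType;
  manifold_hausdorff : hausdorff_space carrier;
  manifold_second_countable : @second_countable carrier;
  atlas : set (chart R n carrier);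
  atlas_cover : forall x, exists2 c, atlas c & chart_dom c x;
  atlas_smooth : forall c d, atlas c -> atlas d ->
    forall k, C_k_compatible k c d }.

Section Manifold.
Context {R : realType} {n : nat} (W : smooth_manifold R n).
Implicit Types (f : W -> R) (L : set W).

Definition C1_function f : Prop :=
  forall c, atlas c -> C_k_on 1 (c @` chart_dom c) (f \o chart_inv c).

(* The coordinate expression, in the chart c, of the differential of f at x. *)
Definition differential_in (c : chart R n W) f (x : W) : 'rV[R]_n -> R :=
  'd (f \o chart_inv c) (c x).

Definition critical_point f (x : W) : Prop :=
  forall c, atlas c -> chart_dom c x ->
    forall v, differential_in c f x v = 0.

Definition C1_chart (c : chart R n W) : Prop :=
  forall a, atlas a -> C_k_compatible 1 a c.

(* The linear subspace R^k x {0} of R^n. *)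
Definition coordinate_subspace (k : nat) : set 'rV[R]_n :=
  [set y | forall i : 'I_n, (k <= i)%N -> y ord0 i = 0].

(* Submanifolds in the sense of slice charts, taken in the maximal C^1 atlas.
   The dimension k may differ from one connected component of L to another. *)
Definition C1_embedded_submanifold L : Prop :=
  forall p, L p -> exists (k : nat) (c : chart R n W),
    [/\ (k <= n)%N, C1_chart c, chart_dom c p &
        c @` (chart_dom c `&` L) =
        (c @` chart_dom c) `&` coordinate_subspace k].

End Manifold.

(* A is a deformation retract of X in the strong sense: the homotopy fixes A
   pointwise at all times. *)
Definition deformation_retract (R : realType) (T : topologicalType)
    (X A : set T) : Prop :=
  A `<=` X /\
  exists H : T * R -> T,
    [/\ {within X `*` `[0, 1], continuous H},
        forall (x : T) (t : R), X x -> 0 <= t <= 1 -> X (H (x, t)),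
        forall x, X x -> H (x, 0) = x,
        forall x, X x -> A (H (x, 1)) &
        forall (a : T) (t : R), A a -> 0 <= t <= 1 -> H (a, t) = a].

(* Main.v *)
Require Import Defs.
From HB Require Import structures.
From mathcomp Require Import all_boot all_order all_algebra.
From mathcomp Require Import all_classical all_reals all_analysis.
From mathcomp Require Import ring lra.

Set Implicit Arguments.
Unset Strict Implicit.
Unset Printing Implicit Defensive.

Import Order.TTheory GRing.Theory Num.Theory.
Import numFieldNormedType.Exports.

Local Open Scope classical_set_scope.
Local Open Scope ring_scope.

(* No flow of a vector field and no tubular neighbourhood is needed: everything
   is composed from finitely many straight-line pushes inside charts.

   In a chart, a point y of a small ball is moved along a fixed direction v by
   half the distance from (y, 0) to the set of pairs (z, s) such that the move
   z |-> z + s v leaves the ball or fails to increase f.  This is continuous, it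
   never decreases f, and it moves y wherever the derivative of f along v is
   positive.  Composing such pushes over a finite cover of W gives a homotopy G
   from the identity to a map h with f (h x) > f x unless x is critical.  By
   compactness every orbit of h starting where f > 0 has f tending to 1;
   stopping the iteration of G suitably deforms W \ Lambda_0 into {f > a}, for
   any a < 1.

   In a slice chart at a point of Lambda_1, shrinking the normal coordinates
   fixes Lambda_1 and sends a neighbourhood of that point into Lambda_1.  A
   finite composition of these does so for a neighbourhood of Lambda_1, which by
   compactness contains {f > a} for some a < 1.  The two deformations are then
   performed one after the other. *)

(** * Iterating a homotopy that raises a function *)

Lemma continuous_pair_at (S T U : topologicalType) (f : S -> T) (g : S -> U) x :
  {for x, continuous f} -> {for x, continuous g} ->
  {for x, continuous (fun y => (f y, g y))}.
Proof. by move=> fx gx; exact: cvg_pair. Qed.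

(** The sets [A] such that [P] holds for [K] minus [A] form a filter containing [K]. If [P K]
    failed, it would be proper and cluster at a point of [K], contradicting [P] near that point. *)
Lemma compact_set_ind (T : topologicalType) (K : set T) (P : set T -> Prop) :
  compact K -> P set0 -> (forall A B, A `<=` B -> P B -> P A) ->
  (forall A B, P A -> P B -> P (A `|` B)) ->
  (forall x, K x -> exists2 U, nbhs x U & P (U `&` K)) ->
  P K.
Proof.
move=> cK P0 Psub PU Ploc; apply: contrapT => nPK.
pose F : set_system T := fun A => P (K `\` A).
have FF : ProperFilter F.
  split; first by rewrite /F setD0.
  split; first by rewrite /F setDT.
  - by move=> A B FA FB; rewrite /F setDIr; exact: PU.
  - by move=> A B AB; apply: Psub; exact: setDS.
have [x [Kx clx]] := cK F FF (eq_ind _ _ P0 _ (esym (setDv K))).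
have [U Ux PUK] := Ploc x Kx.
have FU : F (~` U) by rewrite /F setDE setCK setIC.
by have [y [nUy Uy]] := clx _ _ FU Ux.
Qed.

(** Clamping the time lets homotopies be defined and continuous on all of [W * R], with no subspace
    topology on the time interval. *)
Definition clamp (R : realType) (s : R) : R := Num.max 0 (Num.min 1 s).

Lemma clamp_itv (R : realType) (s : R) : 0 <= clamp s <= 1.
Proof. by rewrite /clamp le_max lexx /= ge_max ler01 /= ge_min lexx. Qed.

Lemma clamp_le0 (R : realType) (s : R) : s <= 0 -> clamp s = 0.
Proof. by move=> s0; apply: max_idPl; rewrite ge_min s0 orbT. Qed.

Lemma clamp_ge1 (R : realType) (s : R) : 1 <= s -> clamp s = 1.
Proof. by move=> s1; rewrite /clamp (min_idPl s1) (max_idPr ler01). Qed.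

Lemma clamp_continuous (R : realType) : continuous (@clamp R).
Proof.
move=> s; apply: (@continuous_max R R (cst 0) (Num.min 1)).
  exact: cvg_cst.
by apply: (@continuous_min R R (cst 1) id); [exact: cvg_cst | exact: cvg_id].
Qed.

Definition ramp (R : realType) (a b u : R) : R := clamp ((b - u) / (b - a)).

Lemma ramp_left (R : realType) (a b u : R) : a < b -> u <= a -> ramp a b u = 1.
Proof.
move=> ab ua; have ba : 0 < b - a by rewrite subr_gt0.
by apply: clamp_ge1; rewrite ler_pdivlMr // mul1r lerD2l lerN2.
Qed.

Lemma ramp_right (R : realType) (a b u : R) : a < b -> b <= u -> ramp a b u = 0.
Proof.
move=> ab bu; have ba : 0 < b - a by rewrite subr_gt0.
by apply: clamp_le0; rewrite ler_pdivrMr // mul0r subr_le0.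
Qed.

Lemma ramp_continuous (R : realType) (a b : R) : continuous (ramp a b).
Proof.
move=> u; apply: (@continuous_comp _ _ _ (fun u =>
  (b - u) / (b - a)) (@clamp R));
  last exact: clamp_continuous.
apply: cvgM; last exact: cvg_cst.
by apply: cvgB; [exact: cvg_cst | exact: cvg_id].
Qed.

Section RaisingFlow.
Context {R : realType} {T : topologicalType} (f : T -> R) (G : T * R -> T).
Hypothesis T_compact : compact [set: T].
Hypothesis f_continuous : continuous f.
Hypothesis G_continuous : continuous G.
Hypothesis G_0 : forall x, G (x, 0) = x.
Hypothesis G_top : forall x s, f x = 1 -> G (x, s) = x.
Hypothesis G_ge : forall x s, f x <= f (G (x, s)).
Hypothesis G_gt : forall x, 0 < f x < 1 -> f x < f (G (x, 1)).

Let h x := G (x, 1).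

Let h_continuous : continuous h.
Proof.
move=> x; apply: (@continuous_comp _ _ _ (fun y : T => (y, 1 : R)) G).
  by apply: continuous_pair_at; [exact: cvg_id | exact: cvg_cst].
exact: G_continuous.
Qed.

Let iter_continuous m : continuous (iter m h).
Proof.
elim: m => [|m IH] x /=; first exact: cvg_id.
by apply: continuous_comp; [exact: IH | exact: h_continuous].
Qed.

Let iter_ge x m k : (m <= k)%N -> f (iter m h x) <= f (iter k h x).
Proof.
move=> /subnK <-; elim: (k - m)%N => [|j IH] //=.
exact: le_trans IH (G_ge _ _).
Qed.

(** Let [z] be a cluster point of the orbit. Since [f] is nondecreasing along the orbit, [f z]
    bounds it from above, and [f z > 0]. If [f z < 1], then [h] raises [f] at [z], hence also at
    orbit points close to [z], past that bound. *)
Lemma iterate_above a x : a < 1 -> 0 < f x -> exists m, a < f (iter m h x).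
Proof.
move=> a1 fx0; pose u m := iter m h x.
have [z [_ clz]] := T_compact (fmap_proper_filter u eventually_filter) filterT.
have above_z c : f z < c -> forall m, f (u m) <= c.
  move=> zc m; rewrite leNgt; apply/negP => cm.
  have Fge : (u @ \oo) [set y | c < f y].
    exists m => // k /= mk; exact: lt_le_trans cm (iter_ge _ mk).
  have zlt : nbhs z [set y | f y < c].
    exact: cvgr_lt _ (@f_continuous z) _ zc.
  have [y [/= cy yc]] := clz _ _ Fge zlt.
  by have := lt_trans cy yc; rewrite ltxx.
have meets A : nbhs z A -> exists m, A (u m).
  move=> zA; have FT : (u @ \oo) (range u) by exists 0%N => // k _; exists k.
  by have [_ [[m _ <-] Am]] := clz _ _ FT zA; exists m.
have [az|za] := ltP a (f z).
  by apply: (meets [set y | a < f y]); exact: cvgr_gt _ (@f_continuous z) _ az.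
have fz1 : f z < 1 := le_lt_trans za a1.
have fz0 : 0 < f z.
  rewrite ltNge; apply/negP => z0.
  have [m] : exists m, f (u m) < f x.
    apply: (meets [set y | f y < f x]); apply: cvgr_lt _ (@f_continuous z) _ _.
    exact: le_lt_trans fx0.
  by rewrite ltNge (@iter_ge x 0 m).
have zhz : f z < f (h z) by apply: G_gt; rewrite fz0.
pose c := (f z + f (h z)) / 2.
have [zc chz] : f z < c /\ c < f (h z) by rewrite /c; split; lra.
(* [h (u m)] is the orbit point of index [m.+1], so the bound [above_z] applies to it. *)
have [m] : exists m, c < f (h (u m)).
  apply: (meets [set y | c < f (h y)]).
  exact: cvgr_gt _ (continuous_comp (@h_continuous z) (@f_continuous _)) _ chz.
by rewrite ltNge (above_z c zc m.+1).
Qed.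

(* Step k is performed at a speed read off the orbit of x under h itself: full
   as long as f <= a there, zero once f >= b.  So the time-1 point agrees with
   the orbit of h until f exceeds a, and only finitely many steps are
   nontrivial, locally uniformly where f > 0. *)
Fixpoint slow_iter a b m (xt : T * R) : T :=
  if m is k.+1
  then G (slow_iter a b k xt, xt.2 * ramp a b (f (iter k h xt.1)))
  else xt.1.

Let slow_iter_continuous a b m : continuous (slow_iter a b m).
Proof.
elim: m => [|m IH] [x t] /=; first exact: cvg_fst.
apply: (@continuous_comp _ _ _ (fun xt : T * R => (slow_iter a b m xt,
  xt.2 * ramp a b (f (iter m h xt.1)))) G); last exact: G_continuous.
apply: continuous_pair_at; first exact: IH.
apply: cvgM; first exact: cvg_snd.
apply: (@continuous_comp _ _ _ fst (fun y => ramp a b (f (iter m h y)))).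
  exact: cvg_fst.
apply: (@continuous_comp _ _ _ (iter m h) (ramp a b \o f)).
  exact: iter_continuous.
by apply: continuous_comp; [exact: f_continuous | exact: ramp_continuous].
Qed.

Let slow_iter_stationary a b x t m k : a < b -> b < f (iter m h x) ->
  (m <= k)%N -> slow_iter a b k (x, t) = slow_iter a b m (x, t).
Proof.
move=> ab bm /subnK <-; elim: (k - m)%N => [|j IH] //=.
rewrite ramp_right ?mulr0 ?G_0 //.
exact: le_trans (ltW bm) (iter_ge _ (leq_addl _ _)).
Qed.

Let slow_iter_ge a b xt m k : (m <= k)%N ->
  f (slow_iter a b m xt) <= f (slow_iter a b k xt).
Proof.
move=> /subnK <-; elim: (k - m)%N => [|j IH] //=.
exact: le_trans IH (G_ge _ _).
Qed.

Let slow_iter_1 a b x m : a < b -> (forall k, (k < m)%N ->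
  f (iter k h x) <= a) ->
  slow_iter a b m (x, 1) = iter m h x.
Proof.
move=> ab; elim: m => //= m IH le_a.
rewrite IH => [|k km]; last by apply: le_a; exact: ltnW.
by rewrite ramp_left ?mul1r // le_a.
Qed.

(** The number of steps [M x] is merely chosen and need not be locally constant. Continuity survives
    because all sufficiently long slow iterations agree, so near [x] the fixed length [M x] may be
    used. *)
Lemma raising_flow a : a < 1 -> exists K : T * R -> T,
  [/\ forall x t, 0 < f x -> {for (x, t), continuous K},
      forall x, K (x, 0) = x,
      forall x t, f x <= f (K (x, t)),
      forall x t, f x = 1 -> K (x, t) = x &
      forall x, 0 < f x -> a < f (K (x, 1))].
Proof.
move=> a1; pose b := (a + 1) / 2.
have [ab b1] : a < b /\ b < 1 by rewrite /b; split; lra.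
have stops x : exists m, 0 < f x -> b < f (iter m h x).
  have [x0|] := boolP (0 < f x); last by exists 0%N.
  by have [m bm] := iterate_above b1 x0; exists m.
pose M x := projT1 (cid (stops x)).
have bM x : 0 < f x -> b < f (iter (M x) h x) := projT2 (cid (stops x)).
exists (fun xt => slow_iter a b (M xt.1) xt); split => /=.
(* Both [m] and [M y] lie past the point where the speed has dropped to zero, so the longer
   iteration is stationary from the shorter one on. *)
- move=> x t x0; have slow_M y s m : 0 < f y -> b < f (iter m h y) ->
      slow_iter a b m (y, s) = slow_iter a b (M y) (y, s).
    move=> y0 bm; have [Mm|mM] := leqP (M y) m.
      by rewrite (slow_iter_stationary _ ab (bM _ y0) Mm).
    by rewrite (slow_iter_stationary _ ab bm (ltnW mM)).
  have near_x : \forall y \near x, 0 < f y /\ b < f (iter (M x) h y).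
    apply: filterI; first exact: cvgr_gt _ (@f_continuous x) _ x0.
    exact: cvgr_gt _ (continuous_comp (@iter_continuous (M x) x)
      (@f_continuous _)) _ (bM x x0).
  have eqK : {near (x, t), slow_iter a b (M x) =1
                           (fun xt => slow_iter a b (M xt.1) xt)}.
    exists ([set y | 0 < f y /\ b < f (iter (M x) h y)], setT).
      by split => //; exact: filterT.
    by move=> [y s] [/= [y0 yb] _]; exact: slow_M.
  apply: cvg_trans; last exact: (@slow_iter_continuous a b (M x) (x, t)).
  by apply: near_eq_cvg; exact: filterS eqK.
- move=> x; elim: (M x) => //= m ->; by rewrite mul0r G_0.
- by move=> x t; exact: (@slow_iter_ge a b (x, t) 0).
- by move=> x t x1; elim: (M x) => //= m ->; exact: G_top.
- move=> x x0.
  (* Before the first index [m] at which the orbit exceeds [a], all speeds are 1. The slow iterate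
     is thus exactly on the orbit at step [m], and later steps cannot lower [f]. *)
  have ex : exists m, a < f (iter m h x).
    by exists (M x); exact: lt_trans ab (bM _ x0).
  case: (ex_minnP ex) => m am mmin.
  have mM : (m <= M x)%N by apply: mmin; exact: lt_trans ab (bM _ x0).
  apply: lt_le_trans (slow_iter_ge a b (x, 1) mM).
  rewrite slow_iter_1 // => k km; rewrite leNgt; apply/negP => /mmin.
  by rewrite leqNgt km.
Qed.
End RaisingFlow.

(** * Straight-line pushes in a chart *)

Lemma near_dist_lt (R : realType) (V : normedModType R) (q y : V) (r : R) :
  `|y - q| < r -> \forall w \near y, `|w - q| < r.
Proof.
apply: (cvgr_lt `|y - q|); apply: cvg_norm.
by apply: cvgB; [exact: cvg_id | exact: cvg_cst].
Qed.

Section ChartFacts.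
Context {R : realType} {n : nat} {W : topologicalType} (c : chart R n W).

Lemma chart_continuous x : chart_dom c x -> {for x, continuous c}.
Proof.
move=> cx; have := @chart_fun_continuous _ _ _ c.
by rewrite (continuous_open_subspace _ (@chart_dom_open _ _ _ c)); apply;
  rewrite inE.
Qed.

Lemma chart_inv_continuous_at y : (c @` chart_dom c) y ->
    {for y, continuous (chart_inv c)}.
Proof.
move=> cy; have := @chart_inv_continuous _ _ _ c.
by rewrite (continuous_open_subspace _ (@chart_img_open _ _ _ c)); apply;
  rewrite inE.
Qed.

Lemma chart_dom_inv y : (c @` chart_dom c) y -> chart_dom c (chart_inv c y).
Proof. by move=> [x cx <-]; rewrite chart_funK. Qed.

Lemma chart_invK y : (c @` chart_dom c) y -> c (chart_inv c y) = y.
Proof. by move=> [x cx <-]; rewrite chart_funK. Qed.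

Lemma chart_dom_nbhs x : chart_dom c x -> nbhs x (chart_dom c).
Proof.
by move=> cx; apply: open_nbhs_nbhs; split => //; exact: chart_dom_open.
Qed.

Lemma chart_img_nbhs y : (c @` chart_dom c) y -> nbhs y (c @` chart_dom c).
Proof.
by move=> cy; apply: open_nbhs_nbhs; split => //; exact: chart_img_open.
Qed.

Lemma chart_closed_ball x : chart_dom c x ->
  exists2 r : R, 0 < r & forall y, `|y - c x| <= r -> (c @` chart_dom c) y.
Proof.
move=> cx; have : nbhs (c x) (c @` chart_dom c) by apply: chart_img_nbhs;
  exists x.
move=> /nbhs_ballP[e /= e0 sub]; exists (e / 2) => [|y yx];
  first by rewrite divr_gt0.
apply: sub; rewrite -ball_normE /= distrC (le_lt_trans yx) //.
by rewrite gtr_pMr // invf_lt1 // ltr1n.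
Qed.

End ChartFacts.

Lemma chart_dist_lt (R : realType) (n : nat) (W : topologicalType)
    (c : chart R n W) (q : 'rV[R]_n) (r : R) x :
  chart_dom c x -> `|c x - q| < r -> \forall y \near x, `|c y - q| < r.
Proof.
move=> cx xr; have := near_dist_lt xr.
by move=> /(chart_continuous cx).
Qed.

Section ChartPush.
Context {R : realType} {n : nat} {W : topologicalType}.
Hypothesis W_hausdorff : hausdorff_space W.
Variables (c : chart R n W) (q : 'rV[R]_n) (r : R).
Variable th : 'rV[R]_n -> 'rV[R]_n.
Hypothesis ball_img : forall y, `|y - q| <= r -> (c @` chart_dom c) y.
Hypothesis th_continuous : continuous th.
Hypothesis th_out : forall y, r <= `|y - q| -> th y = 0.
Hypothesis th_in : forall y, `|y - q| < r -> `|y + th y - q| < r.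

Definition chart_push (xs : W * R) : W :=
  if xs.1 \in chart_dom c
  then chart_inv c (c xs.1 + clamp xs.2 *: th (c xs.1)) else xs.1.

(** Balls are convex, and the moved point is a convex combination of [y] and [y + th y]. *)
Lemma chart_push_ball y s : `|y - q| < r -> `|y + clamp s *: th y - q| < r.
Proof.
move=> yr; have /andP[s0 s1] := clamp_itv s; set t := clamp s in s0 s1 *.
have -> : y + t *: th y - q = (1 - t) *: (y - q) + t *: (y + th y - q).
  by apply/rowP => i; rewrite !mxE; ring.
have [->|t_neq0] := eqVneq t 0.
  by rewrite subr0 scale1r scale0r addr0.
have t0 : 0 < t by rewrite lt_neqAle eq_sym t_neq0.
apply: le_lt_trans (ler_normD _ _) _; rewrite !normrZ.
rewrite (ger0_norm s0) ger0_norm ?subr_ge0 //.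
apply: (@lt_le_trans _ _ ((1 - t) * r + t * r));
  last by rewrite -mulrDl subrK mul1r.
apply: ler_ltD; first by apply: ler_wpM2l; rewrite ?subr_ge0 // ltW.
by rewrite ltr_pM2l // th_in.
Qed.

Lemma chart_push_img x s : chart_dom c x ->
  (c @` chart_dom c) (c x + clamp s *: th (c x)).
Proof.
move=> cx; have [xr|rx] := ltP `|c x - q| r.
  by apply: ball_img; apply: ltW; exact: chart_push_ball.
by rewrite th_out // scaler0 addr0; exists x.
Qed.

Lemma chart_push_dom x s : chart_dom c x -> chart_dom c (chart_push (x, s)).
Proof.
move=> cx; rewrite /chart_push /= mem_set //.
by apply: chart_dom_inv; exact: chart_push_img.
Qed.

Lemma chart_pushE x s : chart_dom c x ->
  c (chart_push (x, s)) = c x + clamp s *: th (c x).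
Proof.
move=> cx; rewrite /chart_push /= mem_set //.
by apply: chart_invK; exact: chart_push_img.
Qed.

Lemma chart_push_id x s : (chart_dom c x -> th (c x) = 0) ->
  chart_push (x, s) = x.
Proof.
rewrite /chart_push /=; case: ifPn => // /set_mem cx /(_ cx) ->.
by rewrite scaler0 addr0 chart_funK.
Qed.

Lemma chart_push0 x : chart_push (x, 0) = x.
Proof.
rewrite /chart_push /=; case: ifPn => // /set_mem cx.
by rewrite clamp_le0 // scale0r addr0 chart_funK.
Qed.

Lemma chart_push_continuous : continuous chart_push.
Proof.
move=> [x s].
have [cx|ncx] := pselect (chart_dom c x).
  pose g (yt : W * R) := chart_inv c (c yt.1 + clamp yt.2 *: th (c yt.1)).
  have eqg : {near (x, s), g =1 chart_push}.
    exists (chart_dom c, setT).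
      by split; [exact: chart_dom_nbhs | exact: filterT].
    by move=> [y t] [/= cy _]; rewrite /chart_push /= mem_set.
  apply: cvg_trans; first by apply: near_eq_cvg; exact: eqg.
  rewrite -(nbhs_singleton eqg).
  apply: (@continuous_comp _ _ _ (fun yt : W * R =>
    c yt.1 + clamp yt.2 *: th (c yt.1)));
    last by apply: chart_inv_continuous_at; exact: chart_push_img.
  have c1 : c yt.1 @[yt --> (x, s)] --> c x.
    by apply: cvg_comp; [exact: cvg_fst | exact: chart_continuous].
  apply: cvgD => //; apply: cvgZ.
    by apply: cvg_comp; [exact: cvg_snd | exact: clamp_continuous].
  by apply: cvg_comp; [exact: c1 | exact: th_continuous].
(* Off the compact, hence closed, preimage K of the ball the push is the
   identity. *)
pose K := chart_inv c @` closed_ball_ Num.Def.normr q r.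
have K_closed : closed K.
  apply: compact_closed => //; apply: continuous_compact.
    apply: continuous_in_subspaceT => y; rewrite inE => yr.
    by apply: chart_inv_continuous_at; apply: ball_img; rewrite distrC.
  apply: bounded_closed_compact; last exact: closed_closed_ball_.
  exists (`|q| + r); split; first by rewrite num_real.
  move=> M qM y /= yr; apply/ltW; apply: le_lt_trans qM.
  rewrite -[y](subrK q) addrC; apply: le_trans (ler_normD _ _) _.
  by rewrite lerD2l distrC.
have Kx : (~` K) x.
  move=> [y yr yx]; apply: ncx; rewrite -yx; apply: chart_dom_inv.
  by apply: ball_img; rewrite distrC.
have eqg : {near (x, s), (fst : W * R -> W) =1 chart_push}.
  exists (~` K, setT).
    split; last exact: filterT.
    by apply: open_nbhs_nbhs; split => //; exact: closed_openC.
  move=> [y t] [/= Ky _]; rewrite chart_push_id // => cy.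
  apply: th_out; rewrite leNgt; apply/negP => yr; apply: Ky.
  by exists (c y); rewrite ?chart_funK // /closed_ball_ /= distrC ltW.
apply: cvg_trans; first by apply: near_eq_cvg; exact: eqg.
by rewrite -(nbhs_singleton eqg); exact: cvg_fst.
Qed.

End ChartPush.

(** * Ascending along a fixed direction *)

Section Reserve.
Context {R : realType} {V : normedModType R}.
Variable bad : V -> R -> Prop.

(* The distance from (y, 0) to the bad pairs with s > 0, for the sum norm.  The
   value 1 only makes the set nonempty, inf set0 being 0. *)
Definition reserve (y : V) : R :=
  inf [set t | t = 1 \/
               exists z s, [/\ 0 < s, bad z s & t = `|y - z| + s]].

Lemma reserve_ge0 y : 0 <= reserve y.
Proof.
apply: lb_le_inf; first by exists 1; left.
by move=> t [->|[z [s [s0 _ ->]]]] //; rewrite addr_ge0 // ltW.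
Qed.

Lemma reserve_le y z s : 0 < s -> bad z s -> reserve y <= `|y - z| + s.
Proof.
move=> s0 bzs; apply: ge_inf; last by right; exists z, s.
by exists 0 => t [->|[z' [s' [s'0 _ ->]]]] //; rewrite addr_ge0 // ltW.
Qed.

(** The pair [(y, s)] is itself at distance [s] from [(y, 0)]. *)
Lemma reserve_good y s : 0 < s -> s < reserve y -> ~ bad y s.
Proof.
move=> s0 sy /(reserve_le y s0); rewrite subrr normr0 add0r.
by move=> /(lt_le_trans sy); rewrite ltxx.
Qed.

Lemma reserve_eq0 y : (forall s, 0 < s -> bad y s) -> reserve y = 0.
Proof.
move=> bady; apply/eqP; rewrite eq_le reserve_ge0 andbT leNgt; apply/negP => y0.
by apply: (@reserve_good y (reserve y / 2)); [lra|lra|apply: bady; lra].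
Qed.

Lemma reserve_gt0 y e : 0 < e ->
  (forall z s, 0 < s -> bad z s -> e <= `|y - z| + s) -> 0 < reserve y.
Proof.
move=> e0 ge_e; apply: (@lt_le_trans _ _ (Num.min 1 e)).
  by rewrite lt_min ltr01.
apply: lb_le_inf; first by exists 1; left.
move=> t [->|[z [s [s0 bzs ->]]]]; rewrite ge_min ?lexx //.
by rewrite ge_e ?orbT.
Qed.

Lemma reserve_lipschitz y y' : reserve y <= reserve y' + `|y - y'|.
Proof.
rewrite -lerBlDr; apply: lb_le_inf; first by exists 1; left.
move=> t [->|[z [s [s0 bzs ->]]]]; rewrite lerBlDr.
  apply: (@le_trans _ _ 1); last by rewrite lerDl.
  apply: ge_inf; last by left.
  by exists 0 => t' [->|[z' [s' [s'0 _ ->]]]] //; rewrite addr_ge0 // ltW.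
apply: le_trans (reserve_le y s0 bzs) _.
rewrite addrAC lerD2r addrC -[y - z](subrKA y') //.
exact: ler_normD.
Qed.

Lemma reserve_continuous : continuous reserve.
Proof.
move=> y; apply/cvgrPdist_lt => e e0; near=> z.
have yz : `|y - z| < e.
  near: z; apply: cvgr_dist_lt => //; exact: cvg_id.
rewrite ltr_norml ltrBlDr ltrNl opprB ltrBlDr; apply/andP; split.
  apply: le_lt_trans (reserve_lipschitz z y) _.
  by rewrite addrC ltrD2r distrC.
by apply: le_lt_trans (reserve_lipschitz y z) _; rewrite addrC ltrD2r.
Unshelve. all: by end_near. Qed.

(** Halving makes the length strictly smaller than the reserve wherever the latter is positive, as
    [reserve_good] demands. *)
Definition step (v y : V) : V := (reserve y / 2) *: v.

Lemma step_continuous v : continuous (step v).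
Proof.
move=> y; apply: cvgZ; last exact: cvg_cst.
by apply: cvgM; [exact: reserve_continuous | exact: cvg_cst].
Qed.

End Reserve.

Section Increase.
Context {R : realType} {V : normedModType R}.

(** The two difference quotients are the same function of [h]. *)
Lemma is_derive_line (F : V -> R) (z v : V) (s : R) :
  derivable F (z + s *: v) v ->
  is_derive s 1 (fun t : R => F (z + t *: v)) ('D_v F (z + s *: v)).
Proof.
pose g (t : R) := F (z + t *: v).
have eqg : (fun h : R => h^-1 *: ((g \o shift s) (h *: 1) - g s)) =
    (fun h => h^-1 *: ((F \o shift (z + s *: v)) (h *: v) - F (z + s *: v))).
  apply/funext => h /=; congr (_ *: (F _ - _)).
  by rewrite /g [h *: 1]mulr1 scalerDl addrCA.
by move=> dF; split; rewrite -/g /derivable /derive eqg.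
Qed.

Lemma line_increasing (F : V -> R) (z v : V) (s : R) : 0 < s ->
  (forall t, 0 <= t <= s -> derivable F (z + t *: v) v) ->
  (forall t, 0 <= t <= s -> 0 < 'D_v F (z + t *: v)) ->
  F z < F (z + s *: v).
Proof.
move=> s0 dF F'_gt0.
have dg t : 0 <= t <= s ->
    is_derive t 1 (fun t : R => F (z + t *: v)) ('D_v F (z + t *: v)).
  by move=> ts; apply: is_derive_line; exact: dF.
have [||c] := @MVT _ (fun t => F (z + t *: v)) (fun t =>
  'D_v F (z + t *: v)) 0 s s0.
- by move=> t; rewrite in_itv /= => /andP[/ltW t0 /ltW ts]; apply: dg;
    rewrite t0.
- apply: derivable_within_continuous => t; rewrite in_itv /= => ts.
  by have [] := dg t ts.
rewrite in_itv /= => /andP[/ltW c0 /ltW cs].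
rewrite scale0r addr0 subr0 -subr_gt0 => ->.
by rewrite mulr_gt0 // F'_gt0 // c0.
Qed.

(** This keeps the bad pairs at distance at least [e] from [(y, 0)], which makes the reserve
    positive at [y]. *)
Lemma uniformly_increasing (F : V -> R) (v y : V) (N : set V) :
  nbhs y N -> (forall w, N w -> derivable F w v) ->
  (forall w, N w -> 0 < 'D_v F w) ->
  exists2 e : R, 0 < e & forall z s, 0 < s -> `|y - z| + s < e ->
    [/\ N z, N (z + s *: v) & F z < F (z + s *: v)].
Proof.
move=> /nbhs_ballP[d /= d0 dN] dF F'_gt0.
(* For t between 0 and s, the norm of y - z - t v is at most (|y - z| + s)(1 + |v|), so the whole
   segment from z to z + s v stays in the ball of radius d. *)
exists (d / (1 + `|v|)) => [|z s s0 zs].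
  by rewrite divr_gt0 // ltr_pwDl.
have inN t : 0 <= t <= s -> N (z + t *: v).
  move=> /andP[t0 ts]; apply: dN; rewrite -ball_normE /= opprD addrA.
  apply: le_lt_trans (ler_normB _ _) _; rewrite normrZ ger0_norm //.
  apply: le_lt_trans (_ : (`|y - z| + s) * (1 + `|v|) < d); last first.
    by rewrite -ltr_pdivlMr // ltr_pwDl.
  have := normr_ge0 v; have := normr_ge0 (y - z).
  by move: `|v| `|y - z| => p o *; nra.
split; first by have := inN 0; rewrite scale0r addr0; apply; rewrite lexx ltW.
  by apply: inN; rewrite lexx ltW.
by apply: line_increasing => // t /inN; [exact: dF | exact: F'_gt0].
Qed.

End Increase.

Section Ascent.
Context {R : realType} {V : normedModType R}.
Variables (F : V -> R) (q : V) (r : R) (v : V).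

(** Every pair starting outside the ball is bad, which forces the displacement to vanish there. *)
Let bad z s := ~ [/\ `|z - q| < r, `|z + s *: v - q| < r & F z < F (z + s *:
  v)].

Definition ascent : V -> V := step bad v.

Lemma ascent_continuous : continuous ascent.
Proof. exact: step_continuous. Qed.

Lemma ascent_out y : r <= `|y - q| -> ascent y = 0.
Proof.
move=> ry; rewrite /ascent /step reserve_eq0 ?mul0r ?scale0r // => s _ [].
by rewrite ltNge ry.
Qed.

Lemma ascent_good y s : ascent y != 0 -> 0 < s <= 1 ->
  `|y + s *: ascent y - q| < r /\ F y < F (y + s *: ascent y).
Proof.
move=> th0 /andP[s0 s1]; have y0 : 0 < reserve bad y.
  rewrite lt_neqAle reserve_ge0 andbT eq_sym.
  by apply: contraNneq th0 => y0; rewrite /ascent /step y0 mul0r scale0r.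
rewrite /ascent /step scalerA; set t := s * _.
have t0 : 0 < t by rewrite mulr_gt0 // divr_gt0.
have ty : t < reserve bad y by rewrite /t; nra.
by have /contrapT[] := reserve_good t0 ty.
Qed.

Lemma ascent_in y : `|y - q| < r -> `|y + ascent y - q| < r.
Proof.
move=> yr; have [->|th0] := eqVneq (ascent y) 0; first by rewrite addr0.
have [|+ _] := @ascent_good y 1 th0; first by rewrite ltr01 lexx.
by rewrite scale1r.
Qed.

Lemma ascent_neq0 y :
  (forall z, `|z - q| < r -> derivable F z v) ->
  (forall z, `|z - q| < r -> {for z, continuous ('D_v F)}) ->
  `|y - q| < r -> 0 < 'D_v F y -> ascent y != 0.
Proof.
move=> dF DFc yr y0.
pose N := [set w | `|w - q| < r] `&` [set w | 0 < 'D_v F w].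
have yN : nbhs y N.
  by apply: filterI; [exact: near_dist_lt | exact: cvgr_gt _ (DFc y yr) _ y0].
have [w [wr _]|w [_]|e e0 eN] := @uniformly_increasing _ _ F v y N yN.
- exact: dF.
- by [].
have : 0 < reserve bad y.
  apply: reserve_gt0 e0 _ => z s s0 badz; rewrite leNgt; apply/negP => zs.
  by apply: badz; have [[? _] [? _] ?] := eN z s s0 zs.
(* A positive reserve yields a nonzero displacement only if [v] is nonzero; the derivative along the
   zero vector would be 0. *)
have v0 : v != 0.
  by apply: contraTneq y0 => ->; have /@derive_val -> := is_derive0 F y;
    rewrite ltxx.
move=> res0; rewrite /ascent /step scaler_eq0 negb_or v0 andbT.
by rewrite gt_eqF // divr_gt0.
Qed.

End Ascent.

(** * Homotopies that raise f, and their composition *)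

Section RaisingPush.
Context {R : realType} {n : nat} {W : topologicalType}.
Hypothesis W_hausdorff : hausdorff_space W.
Variable f : W -> R.
Hypothesis f_le1 : forall x, f x <= 1.

(* The alternative at time 1 also holds off A: knowing only that f does not
   decrease there would not make the property stable under composition. *)
Definition raises_on (A : set W) : Prop := exists G : W * R -> W,
  [/\ continuous G, forall x, G (x, 0) = x,
      forall x s, f x = 1 -> G (x, s) = x,
      forall x s, f x <= f (G (x, s)) &
      forall x, G (x, 1) = x /\ ~ A x \/ f x < f (G (x, 1))].

Lemma raises_on0 : raises_on set0.
Proof.
exists fst; split => //= x; first exact: cvg_fst.
by left; split => //.
Qed.

Lemma raises_onS A B : A `<=` B -> raises_on B -> raises_on A.
Proof.
move=> AB [G [? ? ? ? GB]]; exists G; split => // x.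
by have [[? nB]|] := GB x; [left; split => // /AB | right].
Qed.

(** Both homotopies run on the same clock. Either the first strictly raises [f], and the second does
    not undo this, or it returns [x] exactly, so that the alternative for the second applies at [x]
    itself. *)
Lemma raises_onU A B : raises_on A -> raises_on B -> raises_on (A `|` B).
Proof.
move=> [G [Gc G0 Gt Gge GA]] [H [Hc H0 Ht Hge HB]].
exists (fun xs => H (G xs, xs.2)); split => /=.
- move=> xs; apply: (@continuous_comp _ _ _ (fun xs => (G xs, xs.2)) H);
    last exact: Hc.
  by apply: continuous_pair_at; [exact: Gc | exact: cvg_snd].
- by move=> x; rewrite G0 H0.
- by move=> x s x1; rewrite Gt // Ht.
- by move=> x s; exact: le_trans (Gge _ _) (Hge _ _).
- move=> x; have [[-> nA]|ltfG] := GA x; last first.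
    by right; exact: lt_le_trans ltfG (Hge _ _).
  by have [[-> nB]|] := HB x; [left; split => // -[] | right].
Qed.

Lemma raises_on_bigcup (I : eqType) (s : seq I) (A : I -> set W) :
  (forall i, raises_on (A i)) -> raises_on [set x | exists2 i, i \in s & A i x].
Proof.
move=> rA; elim: s => [|i s IH].
  by apply: raises_onS raises_on0 => x [].
apply: raises_onS (raises_onU (rA i) IH) => x [j].
by rewrite inE => /predU1P[->|js] Aj; [left | right; exists j].
Qed.

Section Push.
Variables (c : chart R n W) (q : 'rV[R]_n) (r : R) (v : 'rV[R]_n).
Let F := f \o chart_inv c.
Hypothesis ball_img : forall y, `|y - q| <= r -> (c @` chart_dom c) y.
Hypothesis F_derivable : forall y, (c @` chart_dom c) y -> derivable F y v.
Hypothesis DF_continuous :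
  forall y, (c @` chart_dom c) y -> {for y, continuous ('D_v F)}.

Let th := ascent F q r v.

Lemma raising_push :
  raises_on [set x | [/\ chart_dom c x, `|c x - q| < r & 0 < 'D_v F (c x)]].
Proof.
have th_out y : r <= `|y - q| -> th y = 0 := @ascent_out _ _ F q r v y.
have th_in y : `|y - q| < r -> `|y + th y - q| < r := @ascent_in _ _ F q r v y.
have th_continuous : continuous th := @ascent_continuous _ _ F q r v.
have img y : `|y - q| < r -> (c @` chart_dom c) y by move=> /ltW/ball_img.
have FE x : chart_dom c x -> F (c x) = f x.
  by move=> cx; rewrite /F /= chart_funK.
have fpush x s : chart_dom c x ->
    f (chart_push c th (x, s)) = F (c x + clamp s *: th (c x)).
  move=> cx; rewrite -(chart_pushE ball_img th_out th_in) // FE //.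
  exact: (chart_push_dom ball_img th_out th_in).
exists (chart_push c th); split.
- exact: (chart_push_continuous W_hausdorff ball_img th_continuous th_out
    th_in).
- exact: chart_push0.
(* A nonzero displacement at a point where [f] is 1 would raise [f] above its maximum. *)
- move=> x s x1; apply: chart_push_id => cx; apply/eqP/negPn/negP => th0.
  have [|_] := ascent_good th0 (s := 1); first by rewrite ltr01 lexx.
  by rewrite FE // x1 ltNge f_le1.
- move=> x s; have [cx|ncx] := pselect (chart_dom c x);
    last by rewrite chart_push_id.
  rewrite fpush // -(FE x cx).
  have [->|th0] := eqVneq (th (c x)) 0; first by rewrite scaler0 addr0.
  have /andP[s0 s1] := clamp_itv s.
  have [->|s_neq0] := eqVneq (clamp s) 0; first by rewrite scale0r addr0.
  have s01 : 0 < clamp s <= 1 by rewrite s1 lt_neqAle eq_sym s_neq0 s0.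
  by have [_ /ltW] := ascent_good th0 s01.
- move=> x; have [cx|ncx] := pselect (chart_dom c x); last first.
    by left; rewrite chart_push_id //; split => // -[].
  have [th0|th0] := eqVneq (th (c x)) 0.
    left; rewrite chart_push_id //; split => // -[_ xr x0].
    have : th (c x) != 0.
      by apply: ascent_neq0 => // y /img;
        [exact: F_derivable | exact: DF_continuous].
    by rewrite th0 eqxx.
  right; rewrite fpush // -(FE x cx) clamp_ge1 //.
  by have [|] := ascent_good th0 (s := 1); first by rewrite ltr01 lexx.
Qed.
End Push.
End RaisingPush.

(** * Noncritical points of a C^1 function *)

Section NoncriticalPoints.
Context {R : realType} {n : nat} (W : smooth_manifold R n) (f : W -> R).
Hypothesis f_C1 : C1_function f.

Lemma C1_derivable (a : chart R n W) y v : atlas a -> (a @` chart_dom a) y ->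
  derivable (f \o chart_inv a) y v.
Proof. by move=> aW ay; apply: diff_derivable; exact: (f_C1 aW).1. Qed.

Lemma C1_derive_continuous (a : chart R n W) y v : atlas a ->
  (a @` chart_dom a) y -> {for y, continuous ('D_v (f \o chart_inv a))}.
Proof.
move=> aW ay; have /= := (f_C1 aW).2 v.
by rewrite (continuous_open_subspace _ (@chart_img_open _ _ _ a)); apply;
  rewrite inE.
Qed.

Lemma C1_function_continuous : continuous f.
Proof.
move=> x; have [a aW ax] := atlas_cover x.
have eqf : {near x, (f \o chart_inv a) \o a =1 f}.
  by apply: filterS (chart_dom_nbhs ax) => y ay /=; rewrite chart_funK.
apply: cvg_trans; first by apply: near_eq_cvg; exact: eqf.
rewrite -(nbhs_singleton eqf); apply: continuous_comp;
  first exact: chart_continuous.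
by apply: differentiable_continuous; apply: (f_C1 aW).1; exists x.
Qed.

(** By the chain rule through the transition map, vanishing of the differential in one chart implies
    it in every other. *)
Lemma critical_pointP (a : chart R n W) x : atlas a -> chart_dom a x ->
  (forall v, 'D_v (f \o chart_inv a) (a x) = 0) -> critical_point f x.
Proof.
move=> aW ax Da0 c cW cx v; rewrite /differential_in.
have dfc : differentiable (f \o chart_inv c) (c x).
  by apply: (f_C1 cW).1; exists x.
have dfa : differentiable (f \o chart_inv a) (a x).
  by apply: (f_C1 aW).1; exists x.
have [[dca _] _] := atlas_smooth cW aW 1.
have dt : differentiable (a \o chart_inv c) (c x) by apply: dca; exists x.
have dfa' : differentiable (f \o chart_inv a) ((a \o chart_inv c) (c x)).
  by rewrite /= chart_funK.
rewrite -deriveE //.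
(* The two expressions agree only near [c x], where both charts are defined; that is enough for
   derivatives. *)
have <- : 'D_v ((f \o chart_inv a) \o (a \o chart_inv c)) (c x) =
          'D_v (f \o chart_inv c) (c x).
  apply: near_eq_derive.
  have cont : {for c x, continuous (chart_inv c)}.
    by apply: chart_inv_continuous_at; exists x.
  have near_a : \forall y \near c x, chart_dom a (chart_inv c y).
    by apply: cont; rewrite chart_funK //; exact: chart_dom_nbhs.
  by apply: filterS near_a => y ay /=; rewrite chart_funK.
rewrite deriveE; last exact: differentiable_comp.
by rewrite diff_comp //= chart_funK // -deriveE.
Qed.

(** By linearity, if no signed basis vector gives a positive derivative, the differential is zero.
    Finitely many directions per chart therefore suffice. *)
Lemma noncritical_direction (a : chart R n W) x : atlas a -> chart_dom a x ->
  ~ critical_point f x -> exists (b : bool) (i : 'I_n),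
    0 < 'D_((-1) ^+ b *: 'e_i) (f \o chart_inv a) (a x).
Proof.
move=> aW ax; apply: contra_notP => none; apply: (critical_pointP aW ax) => v.
have df : differentiable (f \o chart_inv a) (a x).
  by apply: (f_C1 aW).1; exists x.
have De0 i : 'd (f \o chart_inv a) (a x) 'e_i = 0.
  apply/eqP; rewrite eq_le !leNgt; apply/andP; split; apply/negP => lt0;
    apply: none.
    by exists false, i; rewrite deriveE // expr0 scale1r.
  by exists true, i; rewrite deriveE // expr1 scaleN1r linearN oppr_gt0.
rewrite deriveE // (row_sum_delta v) linear_sum big1 // => i _.
by rewrite linearZ /= De0 scaler0.
Qed.

Lemma raises_noncritical (f_le1 : forall x, f x <= 1) :
  compact [set: W] -> raises_on f [set x | ~ critical_point f x].
Proof.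
move=> cW; have hW := @manifold_hausdorff _ _ W.
(* The induction runs over the second factor, while the noncritical set, possibly not compact, stays
   fixed. *)
rewrite -[X in raises_on f X]setIT.
apply: (compact_set_ind (P := fun A =>
  raises_on f ([set x | ~ critical_point f x] `&` A))) cW _ _ _ _.
- by rewrite setI0; exact: raises_on0.
- by move=> A B AB; apply: raises_onS => x [? /AB].
- by move=> A B rA rB; rewrite setIUr; exact: raises_onU.
move=> p _; have [a aW ap] := atlas_cover p.
have [r r0 ball_img] := chart_closed_ball ap.
pose U := [set x | chart_dom a x /\ `|a x - a p| < r].
exists U.
  apply: filterI; first exact: chart_dom_nbhs.
  apply: (chart_dist_lt (c := a)) => //; by rewrite subrr normr0.
pose A bi := [set x | [/\ chart_dom a x, `|a x - a p| < r &
  0 < 'D_((-1) ^+ (bi.1 : bool) *: 'e_(bi.2 : 'I_n)) (f \o chart_inv a) (a x)]].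
have rA bi : raises_on f (A bi).
  apply: (raising_push hW f_le1 ball_img) => y ay.
    exact: C1_derivable.
  exact: C1_derive_continuous.
apply: raises_onS (raises_on_bigcup (enum [set: bool * 'I_n]) rA) =>
  x [ncx [[ax xr] _]].
have [b [i Dx]] := noncritical_direction aW ax ncx.
by exists (b, i); rewrite ?mem_enum ?inE.
Qed.

End NoncriticalPoints.

(** * Retracting a neighbourhood of a submanifold *)

Lemma nonexpansive_continuous (R : realType) (V : normedModType R)
    (N : V -> V) :
  (forall y z, `|N y - N z| <= `|y - z|) -> continuous N.
Proof.
move=> N_le y; apply/cvgrPdist_lt => e e0.
have : \forall z \near y, `|z - y| < e by apply: near_dist_lt;
  rewrite subrr normr0.
by apply: filterS => z; rewrite distrC; exact: le_lt_trans.
Qed.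

Lemma continuous_cutoff (R : realType) (V : normedModType R) (q : V) (a b : R)
    (N : V -> V) : continuous N ->
  continuous (fun y => - ramp a b `|y - q| *: N y).
Proof.
move=> cN y; apply: cvgZ; last exact: cN.
apply: cvgN; apply: (@continuous_comp _ _ _ (fun y => `|y - q|) (ramp a b)).
  apply: cvg_norm; apply: cvgB; first exact: cvg_id.
  exact: cvg_cst.
exact: ramp_continuous.
Qed.

Lemma rV_norm_le (R : realType) (n : nat) (u w : 'rV[R]_n) :
  (forall i, `|u 0 i| <= `|w 0 i|) -> `|u| <= `|w|.
Proof.
move=> uw; rewrite [leLHS]/Num.norm /= mx_normrE; apply/bigmax_leP;
  split=> [|[i j] _] /=.
  exact: normr_ge0.
rewrite ord1; apply: le_trans (uw j) _.
by rewrite [leRHS]/Num.norm /= mx_normrE; apply/bigmax_geP; right;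
  exists (0, j).
Qed.

Section SlicePush.
Context {R : realType} {n : nat}.
Variable k : nat.

Definition normal_part (y : 'rV[R]_n) : 'rV[R]_n :=
  \row_i (if (k <= i)%N then y 0 i else 0).

Lemma normal_partB y z : normal_part y - normal_part z = normal_part (y - z).
Proof. by apply/rowP => i; rewrite !mxE; case: ifP; rewrite ?subr0. Qed.

Lemma normal_part_norm y : `|normal_part y| <= `|y|.
Proof. by apply: rV_norm_le => i; rewrite mxE; case: ifP; rewrite ?normr0. Qed.

Lemma normal_part_continuous : continuous normal_part.
Proof.
apply: nonexpansive_continuous => y z.
by rewrite normal_partB; exact: normal_part_norm.
Qed.

Lemma normal_part_eq0 y : coordinate_subspace k y -> normal_part y = 0.
Proof. by move=> yk; apply/rowP => i; rewrite !mxE; case: ifP => // /yk. Qed.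

Lemma sub_normal_part y : coordinate_subspace k (y - normal_part y).
Proof. by move=> i ki; rewrite !mxE ki subrr. Qed.

(* The norm of 'rV_n is the sup norm, so its balls centred on the coordinate
   subspace are stable under shrinking the normal coordinates. *)
Definition slice_step (q : 'rV[R]_n) (r : R) (y : 'rV[R]_n) : 'rV[R]_n :=
  - ramp (r / 2) r `|y - q| *: normal_part y.

Lemma slice_step_out q r y : 0 < r -> r <= `|y - q| -> slice_step q r y = 0.
Proof.
move=> r0 ry; rewrite /slice_step ramp_right ?oppr0 ?scale0r //.
by rewrite gtr_pMr // invf_lt1 // ltr1n.
Qed.

Lemma slice_step_inner q r y : 0 < r -> `|y - q| <= r / 2 ->
  slice_step q r y = - normal_part y.
Proof.
move=> r0 yr; rewrite /slice_step ramp_left ?scaleN1r //.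
by rewrite gtr_pMr // invf_lt1 // ltr1n.
Qed.

(** Since [q] has zero normal coordinates, each coordinate of [y - q] is either kept or multiplied
    by a factor in [0, 1]. *)
Lemma slice_step_in q r y : coordinate_subspace k q ->
  `|y - q| < r -> `|y + slice_step q r y - q| < r.
Proof.
move=> qk; apply: le_lt_trans; apply: rV_norm_le => i.
rewrite !mxE; case: ifP => ki; last by rewrite mulr0 addr0.
rewrite qk // !subr0 mulNr -[X in X - _]mul1r -mulrBl normrM ler_piMl //.
have /andP[p0 p1] := clamp_itv ((r - `|y - q|) / (r - r / 2)).
by rewrite /ramp ger0_norm ?subr_ge0 // lerBlDr lerDl.
Qed.

Lemma slice_step_continuous q r : continuous (slice_step q r).
Proof. by apply: continuous_cutoff; exact: normal_part_continuous. Qed.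

End SlicePush.

Section Retraction.
Context {R : realType} {n : nat} (W : smooth_manifold R n) (L : set W).

(** The neighbourhood sent into [L] may depend on [x]; [A] only records the points of [L] already
    treated. *)
Definition retracts_near (A : set W) : Prop := exists G : W * R -> W,
  [/\ continuous G, forall x, G (x, 0) = x, forall x s, L x -> G (x, s) = x &
      forall x, L x -> A x -> \forall y \near x, L (G (y, 1))].

Lemma retracts_near0 : retracts_near set0.
Proof. by exists fst; split => //= x; exact: cvg_fst. Qed.

Lemma retracts_nearS A B : A `<=` B -> retracts_near B -> retracts_near A.
Proof. by move=> AB [G [? ? ? GB]]; exists G; split => // x Lx /AB;
  exact: GB. Qed.

Lemma retracts_nearU A B :
  retracts_near A -> retracts_near B -> retracts_near (A `|` B).
Proof.
move=> [G [Gc G0 GL GA]] [H [Hc H0 HL HB]].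
exists (fun xs => H (G xs, xs.2)); split => /=.
- move=> xs; apply: (@continuous_comp _ _ _ (fun xs => (G xs, xs.2)) H);
    last exact: Hc.
  by apply: continuous_pair_at; [exact: Gc | exact: cvg_snd].
- by move=> x; rewrite G0 H0.
- by move=> x s Lx; rewrite GL // HL.
(* H fixes what G already sends into L; and G (y, 1) is close to G (x, 1) = x
   for y close to x in B, so that no shrinking of neighbourhoods is needed. *)
- move=> x Lx [Ax|Bx].
    by apply: filterS (GA x Lx Ax) => y LGy; rewrite HL.
  have cont : {for x, continuous (fun y => G (y, 1))}.
    apply: (@continuous_comp _ _ _ (fun y : W => (y, 1 : R)) G); last exact: Gc.
    by apply: continuous_pair_at; [exact: cvg_id | exact: cvg_cst].
  have : \forall z \near G (x, 1), L (H (z, 1)) by rewrite GL //; exact: HB.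
  by move=> /cont.
Qed.

Lemma retracts_near_slice (k : nat) (c : chart R n W) p : L p ->
    chart_dom c p ->
  c @` (chart_dom c `&` L) = (c @` chart_dom c) `&` coordinate_subspace k ->
  exists2 U, nbhs p U & retracts_near U.
Proof.
move=> Lp cp slice; have [r r0 ball_img] := chart_closed_ball cp.
have r20 : 0 < r / 2 by rewrite divr_gt0.
(* The slice equation is one between images; injectivity of [c] on its domain turns it into a
   pointwise criterion. *)
have LE x : chart_dom c x -> coordinate_subspace k (c x) <-> L x.
  move=> cx; split=> [xk|Lx].
    have : (c @` (chart_dom c `&` L)) (c x) by rewrite slice; split => //;
      exists x.
    by move=> [z [cz Lz] zx]; rewrite -(chart_funK cx) -zx chart_funK.
  have : (c @` (chart_dom c `&` L)) (c x) by exists x.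
  by rewrite slice => -[].
pose th := slice_step k (c p) r.
have qk : coordinate_subspace k (c p) by apply/LE.
have th_out y : r <= `|y - c p| -> th y = 0 by exact: slice_step_out.
have th_in y : `|y - c p| < r -> `|y + th y - c p| < r by exact: slice_step_in.
(* On the half-radius ball the cutoff is 1, so the time-1 push removes the normal part entirely. *)
exists [set x | chart_dom c x /\ `|c x - c p| < r / 2].
  by apply: filterI; [exact: chart_dom_nbhs | apply: chart_dist_lt;
    rewrite ?subrr ?normr0].
exists (chart_push c th); split.
- apply: (chart_push_continuous _ ball_img _ th_out th_in).
    exact: manifold_hausdorff.
  exact: slice_step_continuous.
- exact: chart_push0.
- move=> x s Lx; apply: chart_push_id => cx.
  by rewrite /th /slice_step normal_part_eq0 ?scaler0 //; apply/LE.
- move=> x Lx [cx xr]; have := chart_dist_lt cx xr.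
  apply: filterS2 (chart_dom_nbhs cx) => y cy yr.
  apply/LE; first exact: (chart_push_dom ball_img th_out th_in).
  rewrite (chart_pushE ball_img th_out th_in) // clamp_ge1 // scale1r.
  by rewrite /th slice_step_inner ?ltW //; exact: sub_normal_part.
Qed.

Lemma submanifold_retraction : compact L -> C1_embedded_submanifold L ->
  exists G : W * R -> W,
  [/\ continuous G, forall x, G (x, 0) = x, forall x s, L x -> G (x, s) = x &
      forall x, L x -> \forall y \near x, L (G (y, 1))].
Proof.
move=> cL subL.
suff [G [Gc G0 GL GLL]] : retracts_near L by exists G; split => // x Lx;
  exact: GLL.
apply: compact_set_ind cL _ _ _ _.
- exact: retracts_near0.
- exact: retracts_nearS.
- exact: retracts_nearU.
move=> p Lp; have [k [c [_ _ cp slice]]] := subL p Lp.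
have [U pU rU] := retracts_near_slice Lp cp slice.
by exists U => //; apply: retracts_nearS rU => x [].
Qed.

End Retraction.

(** * The deformation retraction *)

Section Assembly.
Context {R : realType} {W : topologicalType} (f : W -> R).
Hypothesis W_compact : compact [set: W].
Hypothesis f_continuous : continuous f.

(** Compactness is applied jointly with the left neighbourhoods of 1. Near a point with [f x = 1],
    [Q] holds; near any other point [a < f y] fails once [a] exceeds the midpoint of [f x] and 1. *)
Lemma superlevel_near (Q : set W) :
  (forall x, f x <= 1) -> (forall x, f x = 1 -> nbhs x Q) ->
  exists2 a, a < 1 & forall x, a < f x -> Q x.
Proof.
move=> f_le1 nearQ.
have cover x : [set: W] x -> \forall y \near x & a \near 1^'-, a < f y -> Q y.
  move=> _; have := f_le1 x; rewrite le_eqVlt => /predU1P[/nearQ Qx|fx1].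
    by exists (Q, setT) => [|[y a] [/= Qy _] _] //; split => //; exact: filterT.
  pose m := (f x + 1) / 2.
  have [xm m1] : f x < m /\ m < 1 by rewrite /m; split; lra.
  exists ([set y | f y < m], [set a | m < a]).
    by split; [exact: cvgr_lt _ (@f_continuous x) _ xm | exact: nbhs_left_gt].
  by move=> [y a] [/= ym ma] ay; have := lt_trans (lt_trans ym ma) ay;
    rewrite ltxx.
have near1 : \forall a \near 1^'-, [set: W] `<=` (fun y => a < f y -> Q y).
  exact: (compact_near_coveringP _).1 W_compact _ _ _ _ cover.
have [a [aQ a1]] := filter_ex (filterI near1 (nbhs_left_lt (1 : R))).
by exists a => // x; exact: aQ.
Qed.

(** This is the tube lemma over the compact interval of times; it serves to keep the final
    retraction away from the zero set of [f]. *)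
Lemma tube_positive (G : W * R -> W) x : continuous G ->
  (forall s, 0 < f (G (x, s))) ->
  \forall y \near x, forall s, 0 <= s <= 1 -> 0 < f (G (y, s)).
Proof.
move=> Gc fG.
have cover (s : R) : `[0, 1]%classic s ->
  \forall t \near s & y \near x, 0 < f (G (y, t)).
  move=> _; pose g (ty : R * W) := f (G (ty.2, ty.1)).
  have gc : {for (s, x), continuous g}.
    apply: (@continuous_comp _ _ _ (fun ty : R * W => G (ty.2, ty.1)) f);
      last exact: f_continuous.
    apply: (@continuous_comp _ _ _ (fun ty : R * W => (ty.2, ty.1)) G);
      last exact: Gc.
    by apply: continuous_pair_at; [exact: cvg_snd | exact: cvg_fst].
  exact: cvgr_gt _ gc _ (fG s).
have : \forall y \near x, `[0, 1]%classic `<=` (fun t => 0 < f (G (y, t))).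
  exact: (compact_near_coveringP _).1 (@segment_compact R 0 1) _ _ _ _ cover.
by apply: filterS => y H s s01; apply: H; rewrite /= in_itv.
Qed.

End Assembly.

Theorem lemma2p2 (R : realType) (n : nat) (W : smooth_manifold R n)
    (W_connected : connected [set: W]) (W_compact : compact [set: W])
    (f : W -> R) (f_range : forall x, 0 <= f x <= 1) (f_C1 : C1_function f)
    (L0_nonempty : f @^-1` [set 0] !=set0)
    (L1_nonempty : f @^-1` [set 1] !=set0)
    (L0_submanifold : C1_embedded_submanifold (f @^-1` [set 0]))
    (L1_submanifold : C1_embedded_submanifold (f @^-1` [set 1]))
    (f_noncritical : forall x,
      ~ (f @^-1` [set 0] `|` f @^-1` [set 1]) x -> ~ critical_point f x) :
  deformation_retract R (~` (f @^-1` [set 0])) (f @^-1` [set 1]).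
Proof.
have f_continuous : continuous f := C1_function_continuous f_C1.
have f_le1 x : f x <= 1 by have /andP[] := f_range x.
have f_gt0 x : (~` (f @^-1` [set 0])) x <-> 0 < f x.
  have /andP[f0 _] := f_range x; rewrite lt_neqAle f0 andbT eq_sym.
  by split=> [/eqP|/eqP].
have L1_compact : compact (f @^-1` [set 1]).
  apply: (subclosed_compact _ W_compact) => //.
  apply: (@preimage_closed _ _ f [set 1]); last exact: closed_eq.
  by move=> x _; exact: (@f_continuous x).
have [G [Gc G0 G_top G_ge G_gt]] := raises_noncritical f_C1 f_le1 W_compact.
have [P [Pc P0 PL PL1]] := submanifold_retraction L1_compact L1_submanifold.
(* [Q] asks both that [P] end in the level 1 and that its whole track avoid the level 0, since the
   homotopy must stay in the complement of that level. *)
have [x fx1|a a1 Pa] := superlevel_near W_compact f_continuous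
    (Q := [set x | f (P (x, 1)) = 1 /\ forall s, 0 <= s <= 1 ->
      0 < f (P (x, s))]) f_le1.
  apply: filterI; first exact: PL1.
  by apply: (tube_positive f_continuous Pc) => s; rewrite PL // fx1.
have G_increases x : 0 < f x < 1 -> f x < f (G (x, 1)).
  move=> /andP[x0 x1]; have [[_ nc]|//] := G_gt x.
  exfalso; apply: nc; apply: f_noncritical => -[] /= fx.
    by rewrite fx ltxx in x0.
  by rewrite fx ltxx in x1.
have [K [Kc K0 K_ge K_top Ka]] := raising_flow W_compact f_continuous Gc
  G0 G_top G_ge G_increases a1.
split; first by move=> x /= fx1; apply/f_gt0; rewrite fx1.
(* [K] runs during the first half of the time and [P] during the second; clamping holds [P] at time
   0 and then [K] at time 1. *)
exists (fun xt => P (K (xt.1, clamp (2 * xt.2)), clamp (2 * xt.2 - 1)));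
  split => /=.
- apply: continuous_in_subspaceT => -[x t]; rewrite inE => -[/= /f_gt0 x0 _].
  have clamp_at (g : R -> R) : continuous g -> {for (x, t),
    continuous (fun xt : W * R => clamp (g xt.2))}.
    move=> gc; apply: (@continuous_comp _ _ _ snd (@clamp R \o g));
      first exact: cvg_snd.
    by apply: continuous_comp; [exact: gc | exact: clamp_continuous].
  apply: (@continuous_comp _ _ _ (fun xt : W * R =>
    (K (xt.1, clamp (2 * xt.2)), clamp (2 * xt.2 - 1))) P); last exact: Pc.
  apply: continuous_pair_at.
    apply: (@continuous_comp _ _ _ (fun xt : W * R =>
      (xt.1, clamp (2 * xt.2))) K).
      apply: continuous_pair_at; first exact: cvg_fst.
      apply: (clamp_at ( *%R 2)); exact: mulrl_continuous.
    exact: Kc.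
  apply: (clamp_at (fun t => 2 * t - 1)) => s.
  by apply: cvgB; [exact: mulrl_continuous | exact: cvg_cst].
- move=> x t /f_gt0 x0 /andP[t0 t1]; apply/f_gt0.
  have [t2|t2] := leP (2 * t) 1.
    by rewrite [clamp (_ - _)]clamp_le0 ?subr_le0 // P0;
      exact: lt_le_trans (K_ge _ _).
  by rewrite clamp_ge1 ?ltW //; apply: (Pa _ (Ka x x0)).2; exact: clamp_itv.
- by move=> x _; rewrite !clamp_le0 ?K0 ?P0 //; lra.
- move=> x /f_gt0 x0; rewrite !clamp_ge1; [|lra|lra].
  exact: (Pa _ (Ka x x0)).1.
- by move=> x t fx1 _; rewrite K_top // PL.
Qed.
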